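(* Let $H$ be a hypergraph, let $U,V\subseteq V(H)$ be disjoint, and let $r$ be a real number. Then the ratio $|e\cap U|:|e\cap V|=r$ for all $e\in E(H)$ (that is, $|e\cap U|=r\,|e\cap V|$ for all $e\in E(H)$) if and only if $B_H(\chi_U-r\chi_V)=0$.
   Context: A hypergraph $H$ is a pair $(V(H),E(H))$ with $V(H)$ a non-empty finite set (vertices) and $E(H)$ a set of non-empty subsets of $V(H)$ (hyperedges). The edge-vertex incidence matrix $B_H=[b_{ev}]_{e\in E(H),v\in V(H)}$ has $b_{ev}=1$ if $v\in e$ and $b_{ev}=0$ otherwise; for a vector $x:V(H)\to\mathbb{C}$, $(B_Hx)(e)=\sum_{v\in e}x(v)$. For $U\subseteq V(H)$, $\chi_U:V(H)\to\{0,1\}$ is the characteristic function of $U$. The relation $a:b=r$ is understood as $a=rb$. *)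

(* Defs.v *)
From mathcomp Require Import all_boot all_order all_algebra.

Set Implicit Arguments.
Unset Strict Implicit.
Unset Printing Implicit Defensive.

Import GRing.Theory.
Local Open Scope ring_scope.

Record hypergraph := Hypergraph {
  hvertex : finType;
  hedges : {set {set hvertex}};
  hvertex_gt0 : (0 < #|hvertex|)%N;
  hedges_neq0 : set0 \notin hedges
}.

(* Rows are indexed by the edges and columns by the vertices, both through     *)
(* their canonical enumerations [enum_val].                                   *)
Definition incidence_mx (K : nzRingType) (H : hypergraph) :
    'M[K]_(#|hedges H|, #|hvertex H|) :=
  \matrix_(i < #|hedges H|, j < #|hvertex H|)
    ((enum_val j : hvertex H) \in (enum_val i : {set hvertex H}))%:R.

(* A vector x : V(H) -> K is encoded as a column vector whose entry at j is    *)
(* x (enum_val j), matching the columns of [incidence_mx].                    *)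
Definition char_vec (K : nzRingType) (T : finType) (U : {set T}) :
    'cV[K]_#|T| :=
  \col_(j < #|T|) (enum_val j \in U)%:R.

(* Main.v *)
Require Import Defs.
From mathcomp Require Import all_boot all_order all_algebra.
From mathcomp Require Import reals.
From mathcomp Require Import complex.

(** Multiplying the incidence matrix by the characteristic vector of a set [U]
    counts incidences: its row at the edge [e] sums the indicator of [U] over
    [e], giving [#|e :&: U|] ([mul_incidence_char_vec]).  By linearity the entry
    of B_H (chi_U - r chi_V) at [e] is therefore [#|e :&: U| - r * #|e :&: V|],
    computed in the complex numbers.  This entry is the image of a real number
    under the embedding [real_complex], which is injective, so it vanishes
    exactly when the prescribed ratio holds at [e].  Since the rows are in
    bijection with the edges, the vanishing of the whole vector is the ratio
    condition at every edge. *)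

Set Implicit Arguments.
Unset Strict Implicit.
Unset Printing Implicit Defensive.

Import GRing.Theory.

Local Open Scope ring_scope.
Local Open Scope complex_scope.

Lemma mul_incidence_char_vec (K : nzRingType) (H : hypergraph)
    (U : {set hvertex H}) :
  incidence_mx K H *m char_vec K U =
  \col_i #|(enum_val i : {set hvertex H}) :&: U|%:R.
Proof.
apply/colP => i; rewrite !mxE -[in RHS]sum1_card natr_sum [RHS]big_mkcond.
(* The columns are indexed by ordinals; [enum_val] matches them with the
   vertices themselves. *)
rewrite [RHS](big_enum_val (A := hvertex H)) /=.
by apply: eq_bigr => j _; rewrite !mxE -natrM mulnb -in_setI; case: (_ \in _).
Qed.

Theorem theorem2p17 (R : realType) (H : hypergraph) (U V : {set hvertex H})
    (r : R) (disjUV : [disjoint U & V]) :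
  (forall e : {set hvertex H}, e \in hedges H ->
     #|e :&: U|%:R = r * #|e :&: V|%:R)
  <->
  incidence_mx R[i] H *m (char_vec R[i] U - r%:C *: char_vec R[i] V) = 0.
Proof.
have entryE i : (incidence_mx R[i] H *m
    (char_vec R[i] U - r%:C *: char_vec R[i] V)) i 0 =
    (#|(enum_val i : {set hvertex H}) :&: U|%:R
       - r * #|(enum_val i : {set hvertex H}) :&: V|%:R)%:C.
  rewrite mulmxBr -scalemxAr !mul_incidence_char_vec !mxE.
  by rewrite rmorphB rmorphM !rmorph_nat.
split=> [ratioUV | prod0 e eH].
  apply/colP => i; rewrite entryE mxE ratioUV ?enum_valP //.
  by rewrite subrr rmorph0.
move/colP/(_ (enum_rank_in eH e)): prod0.
rewrite entryE mxE enum_rankK_in // => /(fmorph_inj (real_complex R)) /eqP.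
by rewrite subr_eq0 => /eqP.
Qed.
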